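(* For all integers $n\ge k\ge 3$, $$w(n,k)=t(n,k)=\left\lceil\log_2\frac{n-1}{k-2}\right\rceil .$$
   Context: Let $n\ge k\ge 3$ and let $K_n$ be the complete graph on the vertex set $[n]=\{0,1,\dots,n-1\}$. An orientation of the edges of $K_n$ chooses for each edge one of its two directions. A cycle $u_1u_2\dots u_ku_1$ on $k$ distinct vertices is cyclically oriented in an orientation if all its edges are directed consistently around the cycle (in one or the other of the two directions), i.e. it is a directed cycle. A family of orientations of the edges of $K_n$ is called increasingly $k$-cycling if for any $k$-subset $u_1<u_2<\dots<u_k$ of the vertex set there exists an orientation in the family that makes the cycle $u_1u_2\dots u_ku_1$ cyclically oriented. A family of orientations of the edges of $K_n$ is called weakly $k$-cycling if for any $k$-subset $\{w_1,\dots,w_k\}$ of $[n]$ there is an orientation in the family making some $k$-cycle consisting of the vertices $w_1,\dots,w_k$ (in an arbitrary order) cyclically oriented. The minimum number of orientations in a weakly $k$-cycling family for $K_n$ is denoted by $w(n,k)$, and the minimum number of orientations in an increasingly $k$-cycling family for $K_n$ is denoted by $t(n,k)$. *)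

(* Defs.v *)
From mathcomp Require Import all_boot.

Set Implicit Arguments.
Unset Strict Implicit.
Unset Printing Implicit Defensive.

(* [D (x, y)] means that the edge xy of K_n is directed from x to y; exactly
   one of the two directions is chosen for x != y, and there are no loops. *)
Definition is_orientation n (D : {ffun 'I_n * 'I_n -> bool}) : bool :=
  [forall x, ~~ D (x, x)]
  && [forall x, forall y, (x != y) ==> (D (x, y) (+) D (y, x))].

Definition orientation n := {D : {ffun 'I_n * 'I_n -> bool} | is_orientation D}.

Definition arc n (D : orientation n) : rel 'I_n := fun x y => val D (x, y).

Definition cyclically_oriented n (D : orientation n) (c : seq 'I_n) : bool :=
  cycle (arc D) c || cycle (fun x y => arc D y x) c.

Definition increasingly_cycling n k (F : {set orientation n}) : bool :=
  [forall u : k.-tuple 'I_n,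
     sorted (fun x y : 'I_n => x < y) u ==>
     [exists D in F, cyclically_oriented D u]].

Definition weakly_cycling n k (F : {set orientation n}) : bool :=
  [forall W : {set 'I_n}, (#|W| == k) ==>
     [exists D in F, [exists c : k.-tuple 'I_n,
        [&& uniq c, [set x in c] == W & cyclically_oriented D c]]]].

(* The default value [set: _] of [arg min] plays no role when 2 < k: the family
   of all orientations is then cycling, so that w n k and t n k are genuine
   minima (wP and tP below). *)
Definition w n k : nat :=
  #|[arg min_(F < [set: orientation n] | weakly_cycling k F) #|F|]|.

Definition t n k : nat :=
  #|[arg min_(F < [set: orientation n] | increasingly_cycling k F) #|F|]|.

Lemma next_neq (T : eqType) (c : seq T) (x : T) :
  uniq c -> 2 < size c -> x \in c ->
  (next c x != x) /\ (next c (next c x) != x).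
Proof.
move=> Uc sc xc; have [i p def_p] := rot_to xc.
have Up : uniq (x :: p) by rewrite -def_p rot_uniq.
have sp : 2 < size (x :: p) by rewrite -def_p size_rot.
rewrite -!(next_rot i Uc) def_p.
case: p {def_p} Up sp => [|y [|z p]] //= /and3P[].
rewrite !inE !negb_or => /and3P[nxy nxz _] _ _.
by rewrite !eqxx (eq_sym y x) (negbTE nxy) (eq_sym z x).
Qed.

Lemma exists_cyclic_orientation n (c : seq 'I_n) :
  uniq c -> 2 < size c -> exists D : orientation n, cyclically_oriented D c.
Proof.
move=> Uc sc.
pose f := [ffun p : 'I_n * 'I_n => (p.1 != p.2) &&
  ((p.2 == next c p.1) || (p.1 != next c p.2) && (p.1 < p.2))].
have f_or : is_orientation f.
  apply/andP; split; first by apply/forallP=> x; rewrite ffunE eqxx.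
  apply/'forall_forallP=> x y; apply/implyP=> nxy.
  rewrite !ffunE /= (eq_sym y x) nxy /=.
  case: (y =P next c x) => [yE|_]; case: (x =P next c y) => [xE|_] //=.
    have xc : x \in c.
      apply: contraNT nxy => xNc.
      by rewrite yE next_nth (negbTE xNc).
    by have [_] := next_neq Uc sc xc; rewrite -yE -xE eqxx.
  by rewrite -(inj_eq val_inj) in nxy; case: ltngtP nxy.
exists (Sub f f_or); apply/orP; left.
apply: (sub_in_cycle (P := mem c)) (cycle_next Uc); last exact/allP.
move=> x y xc _ /eqP <-; rewrite /arc SubK ffunE /= eqxx andbT.
by rewrite eq_sym; case: (next_neq Uc sc xc).
Qed.

Lemma weakly_cyclingT n k : 2 < k -> weakly_cycling k [set: orientation n].
Proof.
move=> k3; apply/forallP=> W; apply/implyP=> /eqP cW.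
have sW : size (enum W) == k by rewrite -cardE cW.
have [||D cD] := @exists_cyclic_orientation n (enum W).
- exact: enum_uniq.
- by rewrite (eqP sW).
apply/existsP; exists D; rewrite inE /=; apply/existsP; exists (Tuple sW).
by rewrite enum_uniq cD andbT; apply/eqP/setP=> x; rewrite !inE mem_enum.
Qed.

Lemma increasingly_cyclingT n k :
  2 < k -> increasingly_cycling k [set: orientation n].
Proof.
move=> k3; apply/forallP=> u; apply/implyP=> su.
have Uu : uniq u.
  apply: (sorted_uniq _ _ su) => [y x z|x]; first exact: ltn_trans.
  exact: ltnn.
have [|D cD] := exists_cyclic_orientation Uu; first by rewrite size_tuple.
by apply/existsP; exists D; rewrite inE.
Qed.

Lemma wP n k : 2 < k ->
  (exists2 F : {set orientation n}, weakly_cycling k F & #|F| = w n k) /\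
  (forall F : {set orientation n}, weakly_cycling k F -> w n k <= #|F|).
Proof.
move=> k3; rewrite /w; case: arg_minnP => [|F wF minF].
  exact: weakly_cyclingT.
by split; [exists F | exact: minF].
Qed.

Lemma tP n k : 2 < k ->
  (exists2 F : {set orientation n}, increasingly_cycling k F & #|F| = t n k) /\
  (forall F : {set orientation n}, increasingly_cycling k F -> t n k <= #|F|).
Proof.
move=> k3; rewrite /t; case: arg_minnP => [|F wF minF].
  exact: increasingly_cyclingT.
by split; [exists F | exact: minF].
Qed.

(* Main.v *)
Require Import Defs.
From mathcomp Require Import all_boot all_order all_algebra.
From mathcomp Require Import reals exp.
From mathcomp Require Import zify.

Set Implicit Arguments.
Unset Strict Implicit.
Unset Printing Implicit Defensive.

Import GRing.Theory Num.Theory.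

(** Write k = d + 2.  Both numbers are the least m with n - 1 <= 2 ^ m * d.
    Sorting a k-set shows that every increasingly k-cycling family is weakly
    k-cycling, so it suffices to bound weakly cycling families from below and
    to construct an increasingly cycling family.

    Lower bound ([weakly_cycling_lower_bound]).  A vertex that is a source or a
    sink of an orientation restricted to W lies on no directed cycle inside W.
    Fix a vertex v and sort the n - 1 others by the set of those orientations
    of the family that direct the edge away from v.  If n - 1 > 2 ^ m * d,
    where m is the size of the family, then some d + 1 vertices behave alike,
    and together with v they form a k-set in which v is a source or a sink in
    every orientation.

    Upper bound ([increasingly_cycling_upper_bound]).  Put N = 2 ^ m * d + 1 and
    place the vertices on a circle of length N.  The j-th orientation, j < m,
    directs x to y when 2 ^ j times the clockwise distance from x to y has
    residue below N / 2 modulo N.  The two distances between x and y add up to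
    the odd number N, so this is an orientation.  The k clockwise gaps g of an
    increasing cycle are positive and sum to N, and the cycle is directed in the
    j-th orientation as soon as all its gaps have small residues.  If for every
    j < m some gap has a large residue, consider the sum of the quotients
    2 ^ j * g / N, rounded down.  Passing from j to j + 1 doubles each quotient
    and adds 1 to those with a large residue, so after m steps the sum is at
    least 2 ^ m - 1.  But a gap whose last quotient is c is at least c * d + 1,
    so the gaps would sum to at least (2 ^ m - 1) * d + (d + 2) = N + 1
    ([doubling_small_residues]). *)

(** * The lower bound *)

Lemma arc_irrefl n (D : orientation n) x : ~~ Defs.arc D x x.
Proof. by case: D => f f_or; have/andP[/forallP irr _] := f_or; exact: irr. Qed.

Lemma arc_asym n (D : orientation n) x y : Defs.arc D x y -> ~~ Defs.arc D y x.
Proof.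
have [-> | nxy] := eqVneq x y; first by rewrite (negbTE (arc_irrefl D y)).
case: D => f f_or; have/andP[_ /'forall_forallP/(_ x y)] := f_or.
by rewrite nxy /Defs.arc /=; case: (f (x, y)).
Qed.

(** Each of the two traversals of a cycle through [v] enters [v] by an arc, from
    the predecessor or from the successor of [v]. *)
Lemma source_not_cyclically_oriented n (D : orientation n) (c : seq 'I_n) v :
  v \in c -> {in c, forall y, ~~ Defs.arc D y v} -> ~~ cyclically_oriented D c.
Proof.
move=> vc src; apply/norP; split; apply/negP=> cyc.
  by have := prev_cycle cyc vc; apply/negP/src; rewrite mem_prev.
by have := next_cycle cyc vc; apply/negP/src; rewrite mem_next.
Qed.

Lemma sink_not_cyclically_oriented n (D : orientation n) (c : seq 'I_n) v :
  v \in c -> {in c, forall y, ~~ Defs.arc D v y} -> ~~ cyclically_oriented D c.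
Proof.
move=> vc snk; apply/norP; split; apply/negP=> cyc.
  by have := next_cycle cyc vc; apply/negP/snk; rewrite mem_next.
by have := prev_cycle cyc vc; apply/negP/snk; rewrite mem_prev.
Qed.

Lemma pigeonhole_fiber (T U : finType) (f : T -> U) (A : {set T}) (B : {set U})
    d :
  {in A, forall x, f x \in B} -> #|B| * d < #|A| ->
  exists2 b, b \in B & d < #|[set x in A | f x == b]|.
Proof.
move=> fAB ltBA; apply/exists_inP; apply: contraLR ltBA.
move=> /exists_inPn small; rewrite -leqNgt -sum1_card.
rewrite (partition_big f [in B]) //= -sum_nat_const.
apply: leq_sum => b Bb.
by have := small b Bb; rewrite -leqNgt -sum1dep_card.
Qed.

(** The out-pattern of a vertex [y] is the set of orientations that direct the
    edge [vy] away from [v]; there are [2 ^ #|F|] patterns, and more than [d]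
    vertices with one pattern give, with [v], a set that no orientation of [F]
    makes cyclic. *)
Lemma weakly_cycling_lower_bound n d (F : {set orientation n}) :
  weakly_cycling d.+2 F -> n.-1 <= 2 ^ #|F| * d.
Proof.
move=> wF; rewrite leqNgt; apply/negP=> big.
case: n F wF big => // n F wF big; pose v : 'I_n.+1 := ord0.
pose out y := [set D in F | Defs.arc D v y].
have [||S _] := @pigeonhole_fiber _ _ out [set~ v] (powerset F) d.
- by move=> y _; rewrite powersetE; apply/subsetP=> D /setIdP[].
- by rewrite card_powerset cardsC1 card_ord.
case/card_geqP=> s [Us szs sS].
have {}sS y : y \in s -> (y != v) /\ out y = S.
  by move=> /sS; rewrite !inE => /andP[nyv /eqP].
pose W := [set x in v :: s].
have Uvs : uniq (v :: s).
  by rewrite /= Us andbT; apply/negP=> /sS[]; rewrite eqxx.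
have cW : #|W| == d.+2 by rewrite cardsE (card_uniqP Uvs) /= szs.
have/existsP[D /andP[FD /existsP[c /and3P[Uc /eqP cW' cyc]]]] :=
  implyP (forallP wF W) cW.
have mem_c x : (x \in c) = (x \in v :: s).
  by have/setP/(_ x) := cW'; rewrite !inE.
have vc : v \in c by rewrite mem_c mem_head.
have arcS y : y \in c -> y != v -> Defs.arc D v y = (D \in S).
  rewrite mem_c inE => /orP[/eqP-> /eqP//|/sS[_ <-] _].
  by rewrite inE FD.
have arcvv : ~~ Defs.arc D v v := arc_irrefl D v.
apply/negP: cyc; have [SD | nSD] := boolP (D \in S).
  apply: (source_not_cyclically_oriented vc) => y yc.
  by have [->//|nyv] := eqVneq y v; rewrite arc_asym ?arcS.
apply: (sink_not_cyclically_oriented vc) => y yc.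
by have [->//|nyv] := eqVneq y v; rewrite arcS.
Qed.

(** * The upper bound *)

(** The binary digits of [2 ^ m * x %/ N] record the steps [j < m] at which the
    residue of [2 ^ j * x] is at least [N / 2].  If every step is recorded by
    some entry of [g], the quotients sum to at least [2 ^ m - 1], which is one
    too many for entries that sum to [N]. *)
Lemma doubling_small_residues m d (g : seq nat) (N := 2 ^ m * d + 1) :
    all (leq 1) g -> size g = d.+2 -> \sum_(x <- g) x = N ->
  exists2 j, j < m & all (fun x => 2 * ((2 ^ j * x) %% N) < N) g.
Proof.
move=> g_gt0 szg sumg; have N0 : 0 < N by rewrite /N addn1.
pose c j x := (2 ^ j * x) %/ N.
pose good j := all (fun x => 2 * ((2 ^ j * x) %% N) < N) g.
have [/existsP[j jP] | /existsPn bad] := boolP [exists j : 'I_m, good j].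
  by exists j.
have c_large j : j <= m -> 2 ^ j <= (\sum_(x <- g) c j x).+1.
  elim: j => [//|j IHj] ltjm; rewrite expnS.
  have/allPn[y gy ybad] := bad (Ordinal ltjm).
  apply: leq_trans (_ : (2 * \sum_(x <- g) c j x).+2 <= _).
    by have := IHj (ltnW ltjm); lia.
  (* A residue of at least N / 2 carries 1 into the doubled quotient. *)
  have c_double x : c j.+1 x = 2 * c j x + (2 * ((2 ^ j * x) %% N)) %/ N.
    rewrite /c expnS -mulnA {1}(divn_eq (2 ^ j * x) N) mulnDr mulnA.
    by rewrite divnMDl.
  rewrite (eq_bigr _ (fun x _ => c_double x)) big_split /= -big_distrr /=.
  rewrite ltnS -addn1 leq_add2l.
  by rewrite (big_rem y) //= ltn_addr // divn_gt0 // leqNgt.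
(* For a positive quotient c, 2 ^ m * x >= c * N > 2 ^ m * (c * d). *)
have c_small x : 0 < x -> c m x * d + 1 <= x.
  move=> x0; have := leq_trunc_div (2 ^ m * x) N; rewrite -/(c m x).
  case: (posnP (c m x)) => [->|cx0]; first by rewrite mul0n.
  have pm : 0 < 2 ^ m by rewrite expn_gt0.
  rewrite /N mulnDr muln1 mulnCA => le1; rewrite addn1.
  rewrite -(ltn_pmul2l pm); lia.
have : (\sum_(x <- g) c m x) * d + d.+2 <= N.
  rewrite -sumg -szg -sum1_size big_distrl -big_split /= big_seq.
  by rewrite [leqRHS]big_seq; apply: leq_sum => x /(allP g_gt0)/c_small.
have := c_large m (leqnn m); rewrite -(leq_pmul2r (ltn0Sn d)).
rewrite /N; set C := \sum_(x <- g) _; set P := 2 ^ m; nia.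
Qed.

(** The clockwise distance from [x] to [y] on a circle of length [N], with the
    value [N] rather than 0 when [x = y]. *)
Definition cyclic_gap N (x y : nat) : nat := if x < y then y - x else y + N - x.

Lemma cyclic_gap_gt0 N x y : x < N -> 0 < cyclic_gap N x y.
Proof. rewrite /cyclic_gap; case: ifP; lia. Qed.

Lemma all_pairmap (S T : Type) (P : pred T) (f : S -> S -> T) x s :
  all P (pairmap f x s) = path (fun y z => P (f y z)) x s.
Proof. by elim: s x => //= y s IHs x; rewrite IHs. Qed.

(** An increasing cycle winds around the circle exactly once. *)
Lemma sum_cyclic_gap n N (x : 'I_n) p :
    n <= N -> path (fun y z : 'I_n => y < z) x p ->
  \sum_(g <- pairmap (fun y z : 'I_n => cyclic_gap N y z) x (rcons p x)) g = N.
Proof.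
pose gap (y z : 'I_n) := cyclic_gap N y z; rewrite -/gap => lenN.
have telescope q (z : 'I_n) : path (fun y z : 'I_n => y < z) z q ->
    \sum_(g <- pairmap gap z q) g + z = last z q /\ z <= last z q.
  elim: q z => [|y q IHq] z /=; first by rewrite big_nil.
  case/andP=> ltzy /IHq[<- le_yl].
  by rewrite big_cons {1}/gap /cyclic_gap ltzy; lia.
move=> /telescope[sum_p le_x_last]; rewrite -cats1 pairmap_cat big_cat /=.
have lt_last := ltn_ord (last x p).
rewrite big_seq1 [X in _ + X]/gap /cyclic_gap ltnNge le_x_last /=; lia.
Qed.

Definition doubling_arcs n N j : {ffun 'I_n * 'I_n -> bool} :=
  [ffun p : 'I_n * 'I_n =>
     (p.1 != p.2) && (2 * ((2 ^ j * cyclic_gap N p.1 p.2) %% N) < N)].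

(** The distances between [x] and [y] in the two senses sum to [N], and so do
    the residues of their multiples by [2 ^ j], which are nonzero because
    [2 ^ j] is prime to [N]; as [N] is odd, exactly one of the residues is below
    [N / 2]. *)
Lemma doubling_arcs_orientation n N j :
  odd N -> n <= N -> is_orientation (doubling_arcs n N j).
Proof.
move=> oddN lenN; apply/andP; split.
  by apply/forallP=> x; rewrite ffunE eqxx.
apply/'forall_forallP=> x y; apply/implyP=> nxy.
rewrite !ffunE /= (eq_sym y x) nxy /=.
have N0 : 0 < N by case: N oddN {lenN}.
pose a := cyclic_gap N x y; pose b := cyclic_gap N y x.
have [a0 ltaN abN] : [/\ 0 < a, a < N & a + b = N].
  have := ltn_ord x; have := ltn_ord y; move: nxy; rewrite -(inj_eq val_inj) /=.
  move=> nxy_nat lty ltx; rewrite /a /b /cyclic_gap.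
  by case: (ltngtP x y) nxy_nat => // lt _; split; lia.
rewrite -/a -/b; set r := (2 ^ j * a) %% N; set r' := (2 ^ j * b) %% N.
have r0 : r != 0.
  rewrite -[_ == 0]/(N %| 2 ^ j * a) Gauss_dvdr; last first.
    by rewrite coprimeXr // coprimen2.
  by rewrite gtnNdvd.
have ltrN : r < N by rewrite ltn_mod.
have ltr'N : r' < N by rewrite ltn_mod.
have rr' : N %| r + r'.
  by rewrite /dvdn modnDm -mulnDr abN modnMl.
have {}rr' : r + r' = N.
  case/dvdnP: rr' => q rr'; have : q = 1 by nia.
  by rewrite rr' => ->; rewrite mul1n.
have : 2 * r != N by apply: contraTneq oddN => <-; rewrite oddM.
by case: ltngtP => //; case: ltngtP; lia.
Qed.

(** Here [m > 0] makes [2 ^ m * d + 1] odd, and [d > 0] ensures that cycles have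
    at least three vertices. *)
Lemma increasingly_cycling_upper_bound n m d :
    0 < m -> 0 < d -> n <= 2 ^ m * d + 1 ->
  exists2 F : {set orientation n}, increasingly_cycling d.+2 F & #|F| <= m.
Proof.
move=> m0 d0; set N := 2 ^ m * d + 1 => lenN.
have oddN : odd N by rewrite oddD oddM oddX; case: m m0 @N lenN.
pose D j : orientation n :=
  Sub (doubling_arcs n N j) (doubling_arcs_orientation j oddN lenN).
exists [set D j | j : 'I_m].
  apply/forallP=> -[[|x p] szu]; apply/implyP=> /= inc_u; first by [].
  pose gap (y z : 'I_n) := cyclic_gap N y z.
  have [|||j ltjm] := @doubling_small_residues m d (pairmap gap x (rcons p x)).
  - rewrite all_pairmap; apply/(pathP x) => i _; apply: cyclic_gap_gt0.
    exact: leq_trans (ltn_ord _) lenN.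
  - by rewrite size_pairmap size_rcons; apply/eqP.
  - exact: sum_cyclic_gap.
  rewrite all_pairmap => small.
  apply/existsP; exists (D j); apply/andP; split.
    by apply/imsetP; exists (Ordinal ltjm).
  apply/orP; left.
  have Uu : uniq (x :: p).
    apply: (@sorted_uniq _ (fun y z : 'I_n => y < z)) => // [z y t|y].
      exact: ltn_trans.
    exact: ltnn.
  apply: (cycle_from_next Uu) => y yu.
  rewrite /Defs.arc SubK ffunE /= eq_sym.
  have [|-> _ /=] := next_neq Uu _ yu; first by rewrite (eqP szu).
  exact: (next_cycle (p := x :: p) small yu).
by rewrite -[leqRHS](card_ord m); apply: leq_imset_card.
Qed.

(** * The two minima *)

Lemma increasingly_weakly_cycling n k (F : {set orientation n}) :
  increasingly_cycling k F -> weakly_cycling k F.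
Proof.
move=> /forallP incF; apply/forallP=> W; apply/implyP=> /eqP cW.
pose s := sort (fun x y : 'I_n => x <= y) (enum W).
have szs : size s == k by rewrite size_sort -cardE cW.
have Us : uniq s by rewrite sort_uniq enum_uniq.
have inc_s : sorted (fun x y : 'I_n => x < y) s.
  have : sorted ltn (map (@nat_of_ord n) s).
    rewrite ltn_sorted_uniq_leq (map_inj_uniq val_inj) Us sorted_map.
    by apply: sort_sorted => x y; exact: leq_total.
  by rewrite sorted_map => sorted_s; exact: sorted_s.
have/existsP[D /andP[FD cyc]] := implyP (incF (Tuple szs)) inc_s.
apply/existsP; exists D; rewrite FD; apply/existsP; exists (Tuple szs).
by rewrite Us cyc andbT; apply/eqP/setP=> x; rewrite !inE mem_sort mem_enum.
Qed.

Lemma ceil_log2_ratio (R : realType) (p q m : nat) :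
    0 < q -> 2 ^ m.-1 * q < p <= 2 ^ m * q ->
  Num.ceil (ln (p%:R / q%:R : R)%R / ln (2 : R)%R)%R = m%:Z%R.
Proof.
case: m => [|m] q0 /andP[lo hi].
  by have := leq_trans lo hi; rewrite /= ltnn.
have p0 : 0 < p by apply: leq_trans lo.
have q0R : (0 < q%:R :> R)%R by rewrite ltr0n.
have pq0 : (0 < p%:R / q%:R :> R)%R by rewrite divr_gt0 // ltr0n.
have ln2 : (0 < ln (2 : R))%R by rewrite ln_gt0 // ltr1n.
have ln2X (i : nat) : ((i%:Z%:~R : R) * ln 2 = ln (2 ^+ i))%R.
  by rewrite lnXn // mulr_natl.
apply: ceil_def; rewrite ltr_pdivlMr // ler_pdivrMr //.
have -> : (m.+1%:Z - 1 = m%:Z)%R by rewrite -addn1 PoszD addrK.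
rewrite !ln2X ltr_ln ?ler_ln ?posrE ?exprn_gt0 //.
by rewrite ltr_pdivlMr // ler_pdivrMr // -!natrX -!natrM ltr_nat ler_nat lo.
Qed.

Theorem theorem1 (R : realType) (n k : nat) (hk : (3 <= k)%N) (hn : (k <= n)%N) :
  w n k = t n k /\
  ((t n k)%:Z = Num.ceil (ln ((n%:R - 1) / (k%:R - 2) : R) / ln (2 : R)))%R.
Proof.
case: k hk hn => [|[|[|d]]] // hk hn; set k := d.+3 in hk hn *.
have [[F wF cF] w_min] := wP n hk; have [[F' tF' cF'] t_min] := tP n hk.
have le_wt : w n k <= t n k.
  by rewrite -cF'; apply/w_min/increasingly_weakly_cycling.
have lower : n.-1 <= 2 ^ w n k * d.+1.
  by rewrite -cF; apply: weakly_cycling_lower_bound.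
have upper m : 0 < m -> n.-1 <= 2 ^ m * d.+1 -> t n k <= m.
  move=> m0 le_n; have [||G tG] := @increasingly_cycling_upper_bound n m d.+1 m0.
  - by [].
  - by lia.
  by apply: leq_trans; exact: t_min.
(* An empty family would force k - 1 <= n - 1 <= k - 2. *)
have w0 : 0 < w n k.
  rewrite lt0n; apply/eqP=> w_eq0; move: lower.
  by rewrite w_eq0 /k in hn *; lia.
have wt : w n k = t n k by apply/eqP; rewrite eqn_leq le_wt upper.
split; first exact: wt.
have -> : (n%:R - 1 = n.-1%:R :> R)%R.
  by rewrite -subn1 natrB //; apply: leq_trans hn.
have -> : (k%:R - 2 = d.+1%:R :> R)%R by rewrite -natrB.
symmetry; apply: ceil_log2_ratio; rewrite -?wt //.
rewrite lower andbT ltnNge; apply/negP=> le_n.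
(* The construction needs w - 1 > 0; for w - 1 = 0, le_n contradicts n >= k. *)
have [w1 | w1] := posnP (w n k).-1.
  by move: le_n; rewrite w1 /k in hn *; lia.
by have := upper _ w1 le_n; rewrite -wt; lia.
Qed.
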